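(* Let $0<q<1$ and let $G$ be a finite abelian group. For each $n$ let $\Gamma\in G(n,q)$ be an Erdős–Rényi random graph with sandpile group $S$. Then $$\lim_{n\to\infty}\mathbb{P}(S\simeq G)=0.$$
   Context: $G(n,q)$: random graph on the labeled vertex set $[n]=\{1,\dots,n\}$ in which each of the $\binom n2$ possible edges is present independently with probability $q$. Sandpile group: for a graph $\Gamma$ on $[n]$, the Laplacian $L_\Gamma$ is the $n\times n$ integer matrix with $(i,j)$ entry $1$ if $i\neq j$ and $\{i,j\}$ is an edge, $0$ if $i\ne j$ and $\{i,j\}$ is not an edge, and $-\deg(i)$ if $i=j$. Let $Z\subset\mathbb{Z}^n$ be the subgroup of vectors whose coordinates sum to $0$. The column space of $L_\Gamma$ is contained in $Z$, and the sandpile group of $\Gamma$ is $Z/L_\Gamma\mathbb{Z}^n$, a finitely generated abelian group. *)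

(* Defs.v *)
From HB Require Import structures.
From mathcomp Require Import all_boot all_order all_algebra.
From mathcomp Require Import boolp classical_sets reals topology normedtype.
From mathcomp Require Import sequences.

Set Implicit Arguments.
Unset Strict Implicit.
Unset Printing Implicit Defensive.

Import Order.TTheory GRing.Theory Num.Theory.
Import numFieldNormedType.Exports.

Local Open Scope ring_scope.

Definition edge (n : nat) : finType := {e : {set 'I_n} | #|e| == 2}.

(* A simple graph on the n labelled vertices 'I_n = {0, ..., n-1} is given by
   its edge set. *)
Definition graph (n : nat) : finType := {set edge n}.

Definition adj (n : nat) (g : graph n) (i j : 'I_n) : bool :=
  [exists e in g, val e == [set i; j]%SET].

Definition deg (n : nat) (g : graph n) (i : 'I_n) : nat :=
  #|[set j | adj g i j]|.

(* With this sign convention the diagonal is minus the degree. *)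
Definition laplacian (n : nat) (g : graph n) : 'M[int]_n :=
  \matrix_(i, j) (if i == j then - (deg g i)%:Z else (adj g i j : nat)%:Z).

Definition zero_sum (n : nat) : {pred 'cV[int]_n} :=
  [pred v : 'cV[int]_n | \sum_i v i ord0 == 0].

Lemma zero_sum_zmod_closed (n : nat) : zmod_closed (@zero_sum n).
Proof.
split=> [|u v]; rewrite !inE; first by rewrite big1 // => i _; rewrite mxE.
move=> /eqP u0 /eqP v0; under eq_bigr do rewrite !mxE.
by rewrite sumrB u0 v0 subrr.
Qed.

HB.instance Definition _ (n : nat) :=
  GRing.isZmodClosed.Build 'cV[int]_n (@zero_sum n) (@zero_sum_zmod_closed n).

Record zsum (n : nat) : Type :=
  ZSum { zsum_val :> 'cV[int]_n; _ : zsum_val \in @zero_sum n }.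

HB.instance Definition _ (n : nat) := [isSub for @zsum_val n].
HB.instance Definition _ (n : nat) := [Choice of zsum n by <:].
HB.instance Definition _ (n : nat) :=
  [SubChoice_isSubZmodule of zsum n by <:].

Lemma edge2P (n : nat) (i j : 'I_n) (e : edge n) :
  val e = [set i; j]%SET -> i != j.
Proof. by move=> ve; have := valP e; rewrite ve cards2; case: (i != j). Qed.

Lemma adj_sym (n : nat) (g : graph n) (i j : 'I_n) : adj g i j = adj g j i.
Proof. by rewrite /adj finset.setUC. Qed.

Lemma adj_irrefl (n : nat) (g : graph n) (i : 'I_n) : adj g i i = false.
Proof.
by apply/existsP => -[e /andP[_ /eqP /edge2P]]; rewrite eqxx.
Qed.

Lemma laplacian_zero_sum (n : nat) (g : graph n) (x : 'cV[int]_n) :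
  laplacian g *m x \in @zero_sum n.
Proof.
rewrite inE; under eq_bigr do rewrite mxE.
rewrite exchange_big /= big1 // => j _.
rewrite -mulr_suml [X in X * _](_ : _ = 0) ?mul0r //.
rewrite (bigD1 j) //= mxE eqxx /deg cardsE -sum1_card.
rewrite (eq_bigr (fun i => (adj g i j : nat)%:Z)); last first.
  by move=> i /negPf ij; rewrite mxE ij.
rewrite -(big_morph Posz PoszD (erefl _)).
suff -> : (\sum_(i | i != j) adj g i j)%N = (\sum_(i in adj g j) 1)%N.
  by rewrite addNr.
rewrite [RHS]big_mkcond [RHS](bigD1 j) //= [_ \in _]adj_irrefl add0n.
by apply: eq_bigr => i _; rewrite adj_sym -topredE /=; case: (adj g j i).
Qed.

Definition laplacian_image (n : nat) (g : graph n) : {pred zsum n} :=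
  [pred v : zsum n | `[< exists x : 'cV[int]_n, val v = laplacian g *m x >]].

Lemma laplacian_image_zmod_closed (n : nat) (g : graph n) :
  zmod_closed (laplacian_image g).
Proof.
split=> [|u v]; rewrite !inE; first by exists 0; rewrite mulmx0.
move=> [x ux] [y vy]; exists (x - y).
by rewrite raddfB /= mulmxBr -ux -vy.
Qed.

HB.instance Definition _ (n : nat) (g : graph n) :=
  GRing.isZmodClosed.Build (zsum n) (laplacian_image g)
    (laplacian_image_zmod_closed g).

Definition sandpile (n : nat) (g : graph n) : zmodType :=
  Quotient.quot (laplacian_image g).

Definition zmod_isog (A B : zmodType) : Prop :=
  exists f : {additive A -> B}, bijective f.

(* The law of the Erdos-Renyi graph G(n, q): the product over all possible
   edges of Bernoulli distributions of parameter q. *)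
Definition er_weight (R : realType) (n : nat) (q : R) (g : graph n) : R :=
  \prod_(e : edge n) (if e \in g then q else 1 - q).

Definition er_prob (R : realType) (n : nat) (q : R) (A : set (graph n)) : R :=
  \sum_(g : graph n | `[< A g >]) er_weight q g.

Lemma card_edge (n : nat) : #|{: edge n}| = 'C(n, 2).
Proof. by rewrite card_sig -[n in RHS]card_ord -card_draws cardsE. Qed.

(* Given any prescription b on a set F of possible edges, the edges in F agree
   with b with the product probability: total mass one is the case F = set0,
   and mutual independence of the edges with parameter q is the general one. *)
Lemma er_prob_indep (R : realType) (n : nat) (q : R) (F : {set edge n})
    (b : edge n -> bool) :
  er_prob q (fun g => forall e, e \in F -> (e \in g) = b e) =
  \prod_(e in F) (if b e then q else 1 - q).
Proof.
pose w (e : edge n) (c : bool) : R := if c then q else 1 - q.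
pose Q (e : edge n) : pred bool := fun c => (e \in F) ==> (c == b e).
transitivity (\prod_e \sum_(c | Q e c) w e c); last first.
  rewrite [RHS]big_mkcond; apply: eq_bigr => e _; rewrite /Q.
  case: (e \in F) => /=; first by rewrite big_pred1_eq.
  by rewrite big_bool /= addrC subrK.
rewrite bigA_distr_big_dep /er_prob.
rewrite (reindex (fun f : {ffun edge n -> bool} => [set e | f e]%SET)) /=.
  apply: eq_big => [f|f _]; last by apply: eq_bigr => e _; rewrite inE.
  apply/asboolP/familyP => [H e|H e eF].
    by rewrite -topredE /= /Q; apply/implyP => /H; rewrite inE => ->.
  by have := H e; rewrite -topredE /= /Q eF inE => /eqP.
exists (fun g : graph n => [ffun e => e \in g]) => [f _|g _].
  by apply/ffunP => e; rewrite ffunE inE.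
by apply/setP => e; rewrite inE ffunE.
Qed.

(* Main.v *)
(** Let [N = #|G|] and fix two vertices [u <> v].  If [S] is isomorphic to [G]
    then [N] kills the class of [e_u - e_v], so [L x = N (e_u - e_v)] for some
    integral potential [x].  Pairing with [x] shows that the Dirichlet energy
    [sum_(i ~ j) (x_i - x_j)^2] is [N d] with [d = x_v - x_u], while each
    common neighbour of [u] and [v] contributes at least [d^2 / 2] to it.  As
    [d] is an integer and is not [0] (the energy would vanish, hence also
    [L x]), [u] and [v] have at most a fixed number of common neighbours.  In
    [G(n, q)] their number is binomial of parameters [n - 2] and [q^2], so
    this has exponentially small probability, by Markov's inequality applied
    to [2^(- number of common neighbours)]. *)
Require Import Defs.
From mathcomp Require Import all_boot all_order all_algebra fingroup cyclic.
From mathcomp Require Import ring lra zify.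
From mathcomp Require Import boolp classical_sets reals topology normedtype.
From mathcomp Require Import sequences.

Import Order.TTheory GRing.Theory Num.Theory.
Import numFieldNormedType.Exports.

Local Open Scope ring_scope.

Lemma laplacian_mulE n (g : graph n) (x : 'cV[int]_n) (i : 'I_n) :
  (laplacian g *m x) i ord0 =
  \sum_j (adj g i j)%:R * (x j ord0 - x i ord0).
Proof.
rewrite mxE (bigD1 i) //= [RHS](bigD1 i) //= subrr mulr0 add0r mxE eqxx /deg.
under [RHS]eq_bigr do rewrite mulrBr.
rewrite sumrB [RHS]addrC mulNr; congr (- _ + _).
  rewrite -mulr_suml; congr (_ * _).
  rewrite -sum1_card big_mkcond (bigD1 i) //= inE adj_irrefl add0n.
  rewrite -natz natr_sum; apply: eq_bigr => j _.
  rewrite inE; case: (adj g i j); reflexivity.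
by apply: eq_bigr => j /negPf ji; rewrite mxE eq_sym ji natz.
Qed.

(** Summation by parts: one of the two copies of the double sum gets its indices exchanged, and
    [adj_sym] lets the terms at (i, j) combine into minus a square. Ordered pairs see every edge
    twice, whence the [*+ 2]. *)
Lemma dirichlet_energy n (g : graph n) (x : 'cV[int]_n) :
  (\sum_i x i ord0 * (laplacian g *m x) i ord0) *+ 2 =
  - \sum_i \sum_j (adj g i j)%:R * (x j ord0 - x i ord0) ^+ 2.
Proof.
under eq_bigr do rewrite laplacian_mulE mulr_sumr.
rewrite mulr2n [X in X + _]exchange_big -big_split -sumrN /=.
apply: eq_bigr => i _; rewrite -big_split -sumrN /=; apply: eq_bigr => j _.
by rewrite [adj g j i]adj_sym; ring.
Qed.

Lemma card_common_nbrs_le n (g : graph n) (u v : 'I_n) (N : nat)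
    (x : 'cV[int]_n) :
  (0 < N)%N -> u != v ->
  laplacian g *m x = (delta_mx u ord0 - delta_mx v ord0) *+ N ->
  (#|[set k | adj g u k && adj g v k]| <= 4 * N)%N.
Proof.
move=> N0 uv Lx.
have LxE i : (laplacian g *m x) i ord0 = ((i == u)%:R - (i == v)%:R) *+ N.
  by rewrite Lx mulmxnE !mxE !eqxx !andbT.
pose S i := \sum_j (adj g i j)%:R * (x j ord0 - x i ord0) ^+ 2.
have S0 i : 0 <= S i by apply: sumr_ge0 => j _; rewrite mulr_ge0 ?sqr_ge0.
pose d := x v ord0 - x u ord0.
have SE : \sum_i S i = d *+ (2 * N).
  apply: oppr_inj; rewrite -dirichlet_energy.
  under eq_bigr do rewrite LxE mulrnAr mulrBr.
  rewrite sumrMnl sumrB (bigD1 u) //= [X in _ - X](bigD1 v) //=.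
  rewrite !eqxx !big1; first by rewrite /d -mulrnA !mulr1n !mulr1 !addr0 mulnC -mulNrn opprB.
    by move=> i /negPf ->; rewrite mulr0.
  by move=> i /negPf ->; rewrite mulr0.
(* Only the energy at [u] and [v] is kept; the other [S i] are nonnegative. *)
have Suv : S u + S v <= d *+ (2 * N).
  rewrite -SE (bigD1 u) //= (bigD1 v) 1?eq_sym //= addrA lerDl.
  by apply: sumr_ge0.
set C := [set k | _]; set M := #|C|.
(* Parallelogram law at a common neighbour: 2(a - b)^2 + 2(a - c)^2 - (c - b)^2 = (2a - b - c)^2. *)
have SM : d ^+ 2 *+ M <= (S u + S v) *+ 2.
  rewrite /S -big_split /= -sumrMnl -sumr_const big_mkcond.
  apply: ler_sum => k _; rewrite inE /d.
  move: (x k ord0) (x u ord0) (x v ord0) => a b c.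
  case: (adj g u k); case: (adj g v k) => /=; 
    rewrite ?mul1r ?mul0r ?mulrn_wge0 ?addr_ge0 ?sqr_ge0 //.
  rewrite -subr_ge0 (_ : _ - _ = (a - b + (a - c)) ^+ 2) ?sqr_ge0 //; ring.
rewrite leqNgt; apply/negP => NM.
(* Now d^2 M <= 4 N d with M > 4 N, so the integer [d] cannot be positive. Then [S u] vanishes,
   hence so does every term of the Laplacian at [u], where the value should be [N]. *)
have d0 : 0 <= d by nia.
have {}d0 : d = 0 by nia.
have Su : S u = 0 by have := S0 u; have := S0 v; nia.
have := LxE u; rewrite laplacian_mulE eqxx (negPf uv) big1; first by nia.
move=> j _; move/psumr_eq0P: Su => /(_ _ j isT) H.
have {H} := H (fun j _ => mulr_ge0 (ler0n _ _) (sqr_ge0 _)).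
by move/eqP; rewrite mulf_eq0 sqrf_eq0 => /orP[]/eqP->; rewrite ?mul0r ?mulr0.
Qed.

Lemma sandpile_card_common_nbrs_le n (g : graph n) (G : finZmodType)
    (u v : 'I_n) :
  u != v -> zmod_isog (sandpile g) G ->
  (#|[set k | adj g u k && adj g v k]| <= 4 * #|G|)%N.
Proof.
move=> uv [f [h fK _]].
pose w : 'cV[int]_n := delta_mx u ord0 - delta_mx v ord0.
have w0 : w \in @zero_sum n.
  rewrite inE; under eq_bigr do rewrite !mxE andbT.
  rewrite sumrB (bigD1 u) //= [X in _ - X](bigD1 v) //= !eqxx.
  by rewrite !big1 ?subrr // => i /negPf ->.
pose z : zsum n := ZSum w0.
(* By injectivity of [f] this can be checked in [G], whose order kills every element. *)
have : z *+ #|G| \in laplacian_image g.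
  rewrite -[z *+ _]subr0 Quotient.idealrBE; apply/eqP/(can_inj fK).
  rewrite raddfMn raddf0 [LHS](raddfMn f) [RHS](raddf0 f).
  by rewrite -FinRing.zmodXgE -cardsT expg_cardG ?inE.
rewrite inE => -[x]; rewrite raddfMn /= => /esym.
by apply: card_common_nbrs_le => //; apply/card_gt0P; exists 0.
Qed.

Lemma er_weight_ge0 (R : realType) n (q : R) (g : graph n) :
  0 <= q <= 1 -> 0 <= er_weight q g.
Proof.
by case/andP=> q0 q1; apply: prodr_ge0 => e _; case: ifP; rewrite ?subr_ge0.
Qed.

(** Stated as the expectation of an indicator, the form in which it enters the expansion of a
    product of indicators. *)
Lemma er_prob_subset (R : realType) n (q : R) (F : {set edge n}) :
  \sum_(g : graph n) er_weight q g * (F \subset g)%:R = q ^+ #|F|.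
Proof.
rewrite -prodr_const -[RHS](er_prob_indep q F (fun=> true)) /er_prob.
rewrite [RHS]big_mkcond; apply: eq_bigr => g _.
rewrite (_ : `[< _ >] = (F \subset g)); last exact/asboolP/fintype.subsetP.
by case: ifP => _; rewrite ?mulr1 ?mulr0.
Qed.

(* Expanding the product over [i] reduces the expectation to the probabilities
   that [g] contains given unions of the [F i]. *)
Lemma er_mgf_disjoint (R : realType) n (q t : R) (I : finType)
    (F : I -> {set edge n}) :
  (forall i j, i != j -> [disjoint F i & F j]) ->
  \sum_(g : graph n) er_weight q g * \prod_i (1 - t * (F i \subset g)%:R) =
  \prod_i (1 - t * q ^+ #|F i|).
Proof.
move=> disF.
have distr (a : I -> R) : \prod_i (1 - t * a i) =
    \sum_(A : {set I}) \prod_(i in A) (- t * a i).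
  under eq_bigr do rewrite addrC -mulNr.
  by rewrite bigA_distr; apply: eq_bigr => A _; rewrite -big_mkcond.
rewrite distr; under eq_bigr do rewrite distr mulr_sumr.
rewrite exchange_big; apply: eq_bigr => A _ /=.
(* Padding with empty sets keeps the family disjoint and indexed by all of [I], as
   [partition_disjoint_bigcup] expects. *)
pose FA i := if i \in A then F i else finset.set0.
have disFA i j : i != j -> [disjoint FA i & FA j].
  move=> /disF; rewrite /FA -!setI_eq0.
  by case: (i \in A); case: (j \in A); rewrite ?finset.set0I ?finset.setI0.
pose U := (\bigcup_i FA i)%SET.
have UE (g : graph n) : (U \subset g) = [forall i in A, F i \subset g].
  rewrite /U; apply/idP/forall_inP => [/finset.bigcupsP H i iA|H].
    by have := H i isT; rewrite /FA iA.
  apply/finset.bigcupsP => i _.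
  by rewrite /FA; case: ifP => [/H|_] //; rewrite finset.sub0set.
transitivity ((- t) ^+ #|A| * q ^+ #|U|).
  rewrite -er_prob_subset mulr_sumr; apply: eq_bigr => g _.
  rewrite mulrCA; congr (_ * _).
  rewrite big_split /= prodr_const; congr (_ * _).
  have [|] := boolP (U \subset g); rewrite UE.
    by move=> /forall_inP H; rewrite big1 // => i /H ->.
  case/forall_inPn => i iA /negPf Fi.
  by rewrite (bigD1 i) //= Fi mul0r.
rewrite -prodr_const -[q ^+ _]prodr_const.
rewrite (partition_disjoint_bigcup _ (fun=> q) disFA).
rewrite [X in _ * X](bigID (mem A)) /= [X in _ * (_ * X)]big1 ?mulr1; last first.
  by move=> i /negPf iA; rewrite /FA iA big_set0.
rewrite -big_split /=; apply: eq_bigr => i iA.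
by rewrite /FA iA prodr_const.
Qed.

Lemma er_prob_few_subsets (R : realType) n (q : R) (I : finType)
    (F : I -> {set edge n}) (K : nat) :
  0 <= q <= 1 -> (forall i j, i != j -> [disjoint F i & F j]) ->
  er_prob q (fun g => #|[set i | F i \subset g]| <= K)%N <=
  2 ^+ K * \prod_i (1 - 2^-1 * q ^+ #|F i|).
Proof.
move=> q01 disF; rewrite -er_mgf_disjoint // mulr_sumr.
rewrite /er_prob big_mkcond /=; apply: ler_sum => g _.
(* The choice t = 1/2 makes each factor 1/2 or 1, so the product is 2^(-X) with X the number of
   [F i] contained in [g]; on the event X <= K, 2^K 2^(-X) is at least 1. *)
have -> : \prod_i (1 - 2^-1 * (F i \subset g)%:R) =
    2^-1 ^+ #|[set i | F i \subset g]| :> R.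
  rewrite -prodr_const [RHS]big_mkcond; apply: eq_bigr => i _; rewrite inE.
  by case: (_ \subset _); rewrite ?mulr0 ?subr0 // mulr1; field.
have w0 := er_weight_ge0 _ _ _ g q01.
case: asboolP => [H|_]; last by rewrite !mulr_ge0 ?exprn_ge0 ?invr_ge0.
rewrite mulrCA ler_peMr // exprVn ler_pdivlMr ?exprn_gt0 // mul1r.
by rewrite ler_weXn2l ?ler1n.
Qed.

Lemma er_prob_le (R : realType) n (q : R) (A B : set (graph n)) :
  0 <= q <= 1 -> (forall g, A g -> B g) -> er_prob q A <= er_prob q B.
Proof.
move=> q01 AB; rewrite /er_prob big_mkcond [leRHS]big_mkcond.
apply: ler_sum => g _; have w0 := er_weight_ge0 _ _ _ g q01.
by case: asboolP => [/AB ?|_]; case: asboolP.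
Qed.

Lemma er_prob_ge0 (R : realType) n (q : R) (A : set (graph n)) :
  0 <= q <= 1 -> 0 <= er_prob q A.
Proof. by move=> q01; apply: sumr_ge0 => g _; apply: er_weight_ge0. Qed.

Lemma er_prob_few_common_nbrs (R : realType) n (q : R) (u v : 'I_n) (K : nat) :
  0 <= q <= 1 -> u != v ->
  er_prob q (fun g => #|[set k | adj g u k && adj g v k]| <= K)%N <=
  2 ^+ K * (1 - 2^-1 * q ^+ 2) ^+ (n - 2).
Proof.
move=> q01 uv.
have edgeP (a b : 'I_n) : a != b -> #|[set a; b]| == 2 by rewrite cards2 => ->.
(* Each of the n - 2 other vertices k is a common neighbour once [g] contains the pair [F k] of
   edges joining it to [u] and [v]; distinct k give disjoint pairs. *)
pose I := {k : 'I_n | k \notin [set u; v]}.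
have kN (k : I) : (u != val k) * (v != val k).
  by have := valP k; rewrite !inE negb_or ![val k == _]eq_sym => /andP[].
pose eu (k : I) : edge n := exist _ [set u; val k] (edgeP _ _ (kN k).1).
pose ev (k : I) : edge n := exist _ [set v; val k] (edgeP _ _ (kN k).2).
pose F k := [set eu k; ev k].
have euv k l : eu k != ev l.
  apply/eqP => /(congr1 val)/= /setP/(_ u).
  by rewrite !inE eqxx (negPf uv) (negPf (kN l).1).
have pair_inj w (k l : I) :
    w != val k -> [set w; val k] = [set w; val l] -> k = l.
  move=> wk /setP/(_ (val k)); rewrite !inE eqxx orbT eq_sym (negPf wk) /=.
  by move/esym/eqP/val_inj.
have disF k l : k != l -> [disjoint F k & F l].
  move=> kl; rewrite -setI_eq0; apply/eqP/setP => e; rewrite !inE.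
  apply/negP => /andP[/orP[]/eqP-> /orP[]].
  - by move/eqP/(congr1 val)/(pair_inj _ _ _ (kN k).1)/eqP; rewrite (negPf kl).
  - by rewrite (negPf (euv _ _)).
  - by rewrite eq_sym (negPf (euv _ _)).
  - by move/eqP/(congr1 val)/(pair_inj _ _ _ (kN k).2)/eqP; rewrite (negPf kl).
have cI : #|{: I}| = (n - 2)%N.
  by rewrite card_sig -[n in RHS]card_ord -(cardC [set u; v]) cards2 uv addKn.
have -> : (1 - 2^-1 * q ^+ 2) ^+ (n - 2) =
    \prod_(k : I) (1 - 2^-1 * q ^+ #|F k|).
  by under eq_bigr do rewrite cards2 euv; rewrite prodr_const cI.
apply: le_trans (er_prob_few_subsets _ _ _ _ _ _ q01 disF).
apply: er_prob_le => // g; apply: leq_trans.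
rewrite -(card_imset _ val_inj); apply: subset_leq_card.
apply/fintype.subsetP => _ /imsetP[k + ->].
rewrite !inE finset.subUset !finset.sub1set => /andP[uk vk].
by apply/andP; split; apply/existsP; [exists (eu k)|exists (ev k)]; apply/andP.
Qed.

Local Open Scope classical_set_scope.

Theorem corollary9p3 (R : realType) (q : R) (G : finZmodType) :
  0 < q < 1 ->
  (fun n : nat => er_prob q [set g : graph n | zmod_isog (sandpile g) G])
    @ \oo --> (0 : R).
Proof.
move=> /andP[q0 q1].
have q01 : 0 <= q <= 1 by rewrite !ltW.
have qq : 0 < q ^+ 2 < 1 by rewrite exprn_gt0 // exprn_ilt1 // ltW.
(* With n + 2 vertices, 0 and 1 can serve as [u] and [v], and the exponent n - 2 of the bound
   becomes n, giving a geometric sequence. *)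
rewrite -(cvg_shiftn 2).
apply: (@squeeze_cvgr _ _ _ _ (fun=> 0)
  (geometric (2 ^+ (4 * #|G|)) (1 - 2^-1 * q ^+ 2))).
- apply: nearW => n; rewrite er_prob_ge0 //=.
  have n0 : (0 < n + 2)%N by rewrite addn2.
  have n1 : (1 < n + 2)%N by rewrite addn2.
  have uv : Ordinal n0 != Ordinal n1 by [].
  have := er_prob_few_common_nbrs _ _ _ _ _ (4 * #|G|) q01 uv.
  rewrite addnK; apply: le_trans; apply: er_prob_le => // g.
  exact: sandpile_card_common_nbrs_le.
- exact: cvg_cst.
- apply: cvg_geometric; rewrite ger0_norm; lra.
Qed.
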